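(* Let $a,b,c$ be free parameters (indeterminates). For every integer $n\ge 0$, $$\sum_{\pi\in\mathcal R,\ \sigma(\pi)=n}\omega(\pi)=\sum_{(\pi_1;\pi_2;\pi_3)\in\mathcal V,\ \sigma(\pi_1)+\sigma(\pi_2)+\sigma(\pi_3)=n}a^{\nu(\pi_1)}\,b^{\nu(\pi_2)}\,c^{\nu(\pi_3)},$$ where $\mathcal R$ is the set of Rogers-Ramanujan partitions, $\omega(\pi)$ is the multiplicative weight defined through the chains of $\pi$, and $\mathcal V$ is the set of vector partitions, all as defined in the context.
   Context: For a partition $\pi$, $\sigma(\pi)$ denotes the sum of its parts and $\nu(\pi)$ the number of its parts (the empty partition has $\sigma=\nu=0$). $\mathcal R$ is the set of all Rogers-Ramanujan partitions, i.e. partitions in which any two parts differ by at least 2 (the empty partition is included). Given $\pi\in\mathcal R$, a chain $\chi$ of $\pi$ is a maximal block of parts of $\pi$ in which consecutive parts differ by exactly 2; every $\pi\in\mathcal R$ decomposes uniquely into chains, and all parts of a chain have the same parity. For a chain $\chi$, its length $\ell=\ell(\chi)$ is its number of parts and $\lambda(\chi)$ is its least part. The weight of a chain $\chi$ of length $\ell$ is $$\omega(\chi)=\begin{cases} c^{\ell-1}(c+ab), & \text{if }\lambda(\chi)\text{ is even},\\[2pt] a^{\ell}+(1+c)\sum_{k=1}^{\ell-1}a^kb^{\ell-k}+b^{\ell}, & \text{if }\lambda(\chi)=1,\\[2pt] (1+c)\Big\{a^{\ell}+(1+c)\sum_{k=1}^{\ell-1}a^kb^{\ell-k}+b^{\ell}\Big\},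 & \text{if }\lambda(\chi)>1\text{ is odd},\end{cases}$$ and the weight of $\pi\in\mathcal R$ is $\omega(\pi)=\prod_{\chi}\omega(\chi)$, the product over all chains $\chi$ of $\pi$ (the empty product is 1). $\mathcal V$ is the set of all vector partitions $(\pi_1;\pi_2;\pi_3)$ such that $\pi_1$ and $\pi_2$ are each partitions into distinct odd parts and $\pi_3$ is a partition into distinct even parts (any component may be empty). *)

(* Defs.v *)
From HB Require Import structures.
From mathcomp Require Import all_boot all_order all_algebra.
From mathcomp Require Import finmap.
From mathcomp Require Import boolp classical_sets functions cardinality fsbigop.
Set Implicit Arguments.
Unset Strict Implicit.
Unset Printing Implicit Defensive.
Import GRing.Theory.

Local Open Scope ring_scope.

(* A partition is the weakly decreasing sequence of its parts, so that sumn is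
   the sum of the parts and size is the number of parts. *)
Definition is_partition (p : seq nat) : bool :=
  sorted geq p && all (leq 1) p.

Definition rogers_ramanujan (p : seq nat) : bool :=
  is_partition p && pairwise (fun x y => (y + 2 <= x)%N) p.

(* The chains of p, listed from the largest part down; see chainsP and
   chains_unique below. *)
Fixpoint chains (p : seq nat) : seq (seq nat) :=
  if p is x :: q then
    if chains q is chi :: cs then
      if x == (head 0 chi + 2)%N then (x :: chi) :: cs else [:: x] :: chi :: cs
    else [:: [:: x]]
  else [::].

Definition chain_weight (R : comNzRingType) (a b c : R) (chi : seq nat) : R :=
  let l := size chi in
  let lambda := last 0%N chi in
  let s := a ^+ l
           + (1 + c) * (\sum_(1 <= k < l) a ^+ k * b ^+ (l - k)) + b ^+ l in
  if ~~ odd lambda then c ^+ (l - 1) * (c + a * b)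
  else if lambda == 1%N then s
  else (1 + c) * s.

Definition weight (R : comNzRingType) (a b c : R) (p : seq nat) : R :=
  \prod_(chi <- chains p) chain_weight a b c chi.

Definition distinct_odd (p : seq nat) : bool :=
  [&& is_partition p, uniq p & all odd p].

Definition distinct_even (p : seq nat) : bool :=
  [&& is_partition p, uniq p & all (fun x => ~~ odd x) p].

Definition vector_partition (v : seq nat * seq nat * seq nat) : bool :=
  [&& distinct_odd v.1.1, distinct_odd v.1.2 & distinct_even v.2].

Definition RR_of (n : nat) : set (seq nat) :=
  [set p | rogers_ramanujan p /\ sumn p = n]%classic.

Definition VP_of (n : nat) : set (seq nat * seq nat * seq nat) :=
  [set v | vector_partition v
           /\ (sumn v.1.1 + sumn v.1.2 + sumn v.2)%N = n]%classic.

Definition is_block (chi : seq nat) : bool :=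
  (chi != [::]) && sorted (fun x y => x == (y + 2)%N) chi.

Definition separated (chi chi' : seq nat) : bool :=
  last 0%N chi != (head 0%N chi' + 2)%N.

Lemma chainsP (p : seq nat) :
  [/\ flatten (chains p) = p, all is_block (chains p)
    & sorted separated (chains p)].
Proof.
elim: p => [//|x q [fl bl se]] /=; case: (chains q) fl bl se => [|chi cs] /=.
  by move=> <-.
move=> fl /andP[bc bl] se; case: eqP => [xE|xN] /=; last first.
  by split=> //=; rewrite ?fl ?bc ?bl // se andbT /separated /=; apply/eqP.
split; first by rewrite fl.
  case: chi {fl se} bc xE => [//|y chi] /andP[_ /= yc] ->.
  by rewrite /is_block /= eqxx yc bl.
case: chi {fl} bc xE se => [//|y chi] _ _.
by case: cs {bl} => [|d cs].
Qed.

Lemma chains_unique (cs : seq (seq nat)) :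
  all is_block cs -> sorted separated cs -> chains (flatten cs) = cs.
Proof.
elim: cs => [//|chi cs IH] /= /andP[bc bl] se.
have {}IH : chains (flatten cs) = cs by apply: IH => //; apply: path_sorted se.
elim: chi bc se => [//|x [|y chi] IHc] /=; rewrite /is_block /=.
  move=> _; rewrite IH; case: cs {bl IH IHc} => [//|d cs] /= /andP[+ _].
  by rewrite /separated /= => /negbTE ->.
move=> /andP[/eqP xE yc] se; have /= -> := IHc yc; first by rewrite xE eqxx.
by case: cs se {bl IH IHc} => [//|d cs] /=.
Qed.

Lemma finite_bounded_partitions (n : nat) :
  finite_set [set p | is_partition p /\ (sumn p <= n)%N]%classic.
Proof.
pose f (t : n.-bseq 'I_n.+1) : seq nat := map val t.
apply: (@sub_finite_set _ _ [set f t | t in [set: n.-bseq 'I_n.+1]]%classic);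
  last exact/finite_image/finite_finset.
move=> p /= [/andP[_ pos] le_pn].
have szp : (size p <= n)%N.
  apply: leq_trans le_pn; elim: p pos => //= x p IH /andP[x1 /IH].
  by move=> h; rewrite -add1n leq_add.
have ltp : all (fun x => x < n.+1)%N p.
  apply/allP => x; rewrite ltnS => xp; apply: leq_trans le_pn.
  elim: p xp {pos szp} => //= y p IH; rewrite inE => /orP[/eqP ->|/IH h].
    exact: leq_addr.
  exact: leq_trans h (leq_addl _ _).
have szq : (size (map (@inord n) p) <= n)%N by rewrite size_map.
exists (Bseq szq) => //; rewrite /f /= -map_comp -[RHS]map_id.
by apply/eq_in_map => x /(allP ltp) /= xn; rewrite inordK.
Qed.

Lemma finite_RR_of (n : nat) : finite_set (RR_of n).
Proof.
apply: sub_finite_set (finite_bounded_partitions n) => p /= [].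
by case/andP=> pp _ ->.
Qed.

Lemma finite_VP_of (n : nat) : finite_set (VP_of n).
Proof.
have F := finite_bounded_partitions n.
apply: sub_finite_set (finite_setX (finite_setX F F) F).
move=> -[[p q] r] /= [/and3P[/and3P[/= pp _ _] /and3P[/= qq _ _]]].
move=> /and3P[/= rr _ _] /= <-; do !split => //=.
- by rewrite -addnA leq_addr.
- by rewrite addnAC leq_addl.
- exact: leq_addl.
Qed.

(* Main.v *)
Require Import Defs.
From mathcomp Require Import all_boot all_order all_algebra.
From mathcomp Require Import classical_sets fsbigop.
From mathcomp Require Import ring zify.

(** Why the theorem is true.  Write [p] for [q ^+ 2].  The vector partitions are
    generated by the product over [i] of
      [(1 + a q p^i) (1 + b q p^i) (1 + c p^(i+1))],
    so the weighted count of the Rogers-Ramanujan partitions has to be shown to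
    be this product.

    Read a partition from its least part upwards.  The weight of an odd chain
    expands into words [a..ab..b], one letter for each part; there is a factor
    [1 + c] where [a] changes to [b], and another one at the bottom of the chain
    unless the least part is 1.  So the possible bottoms of a partition are: a
    part 1 that carries [a] (series [V]), a part 1 that carries [b] (series
    [U]), no part 1 (series [Y]).  Each series is kept as a sequence indexed by
    the number of parts, that is, as a power series in a variable [x].  Adding 2
    to all [k] parts multiplies the [k]-th term by [p ^+ k] (operator [eta]: [x]
    becomes [x p]), and adding a new least part is the multiplication by [x]
    (operator [shift]).  With [T = V + U + Y], [W = T + c U] and
    [X = (1 + c) T - c Y], removing the least part gives
      [V = q a x eta W],   [U = q b x eta (U + Y)],
      [Y = eta X + p x (a b eta (eta X) + c eta Y)]
    ([sum_from_a_rec], [sum_from_b_rec], [sum_rec_odd], [sum_rec_even] and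
    [sums_shift]).

    What is wanted is [T] at [x = 1].  For a sequence [F] let [L_n F] be
    [(p; p)_n] times the coefficient of [x^n] in [F(x) / (x; p)_oo]
    ([bounded_sum]); as [n] grows it tends to [F] at [x = 1].  If [c = 0], the
    equations say at once that [L_n T] is the product of the [n] first factors.
    In general terms in [abc] have to be added:
      [sum_j (abc)^j p^(jn + j(j+1)/2) [n, j]_p L_(n-j) (eta^j T)]
        [= prod_(i < n) (1 + a q p^i) (1 + b q p^i) (1 + c p^(i+1))].
    Their exponents contain [jn], so they disappear in the limit.  The left-hand
    side is [key_sum] with [e = 1]; its three transformation rules
    [key_sum_shift], [key_sum_eta] and [key_sum_step], applied to the functional
    equations, give the recurrence [key_sum_product] in [n].

    No limit is ever taken.  Only the coefficient of [q^n] matters, so [q] may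
    be taken in a commutative ring where [q ^+ n.+1 = 0] ([truncation_ring]):
    there all series are finite sums, [1 - q ^+ m] can be cancelled, and the
    product equals the sum of all [T k] as soon as it has enough factors
    ([rr_generating_function]). *)

Set Implicit Arguments.
Unset Strict Implicit.
Import GRing.Theory.
Local Open Scope ring_scope.

(** * Gaussian binomials and sums bounded by the number of parts *)

Section Bounded.
Variables (A : comNzRingType) (p : A).
Implicit Types (F G : nat -> A) (n j k e : nat).

Fixpoint qbinom n k : A :=
  match n, k with
  | _, 0 => 1
  | 0, _.+1 => 0
  | n'.+1, k'.+1 => qbinom n' k' + p ^+ k'.+1 * qbinom n' k'.+1
  end.

#[global] Arguments qbinom n k : simpl never.

Lemma qbinom0 n : qbinom n 0 = 1. Proof. by case: n. Qed.

Lemma qbinomS n k :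
  qbinom n.+1 k.+1 = qbinom n k + p ^+ k.+1 * qbinom n k.+1.
Proof. by []. Qed.

Lemma qbinom_small n k : (n < k)%N -> qbinom n k = 0.
Proof.
elim: n k => [|n IH] [|k] //; rewrite ltnS => lt_nk.
by rewrite qbinomS !IH ?mulr0 ?addr0 // ltnW.
Qed.

(** Together with [qbinom_absorbC], this stands for the quotient formula
    [(p; p)_n / ((p; p)_k (p; p)_(n-k))], which does not make sense in a ring
    where the factors need not be invertible. *)
Lemma qbinom_absorb n k :
  (1 - p ^+ k.+1) * qbinom n.+1 k.+1 = (1 - p ^+ n.+1) * qbinom n k.
Proof.
elim: n k => [|n IH] k.
  case: k => [|k]; last by rewrite !(@qbinom_small _ k.+1) ?qbinom_small // !mulr0.
  by rewrite qbinomS !qbinom0 qbinom_small //; ring.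
case: k => [|k].
  rewrite qbinomS !qbinom0.
  transitivity ((1 - p) + p * ((1 - p ^+ 1) * qbinom n.+1 1)); first by ring.
  by rewrite IH qbinom0 !exprS; ring.
have E := IH k; have E' := IH k.+1.
have {}E : p ^+ k.+1 * qbinom n.+1 k.+1 =
           p ^+ k.+1 * qbinom n k.+1 + p ^+ n.+1 * qbinom n k.
  transitivity (qbinom n.+1 k.+1 - (1 - p ^+ k.+1) * qbinom n.+1 k.+1).
    by ring.
  by rewrite E qbinomS; ring.
transitivity (qbinom n.+1 k.+1 - p * (p ^+ k.+1 * qbinom n.+1 k.+1)
  + p * p ^+ k.+1 * ((1 - p ^+ k.+2) * qbinom n.+1 k.+2)).
  by rewrite (qbinomS n.+1) !exprS; ring.
by rewrite E' E qbinomS !exprS; ring.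
Qed.

Lemma qbinom_absorbC n k : (k <= n.+1)%N ->
  (1 - p ^+ (n.+1 - k)) * qbinom n.+1 k = (1 - p ^+ n.+1) * qbinom n k.
Proof.
elim: n k => [|n IH] [|k]; rewrite ?subn0 ?qbinom0 // ltnS subSS => le_kn.
  by rewrite (@qbinom_small 0) // sub0n expr0 subrr mul0r mulr0.
have pE : p ^+ n.+2 = p ^+ (n.+1 - k) * p ^+ k.+1.
  by rewrite -exprD addnS subnK.
have E : (1 - p ^+ (n.+1 - k)) * qbinom n.+1 k =
         (1 - p ^+ k.+1) * qbinom n.+1 k.+1.
  by rewrite IH // qbinom_absorb.
rewrite (qbinomS n.+1) mulrDr E pE; ring.
Qed.

(** [bounded_sum n F] is the sum of [F k] times the product of [1 - p ^+ (n - i)]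
    over [i < k], written in Horner form: the coefficient of [x^n] in
    [F(x) / (x; p)_oo], times [(p; p)_n]. *)
Fixpoint bounded_sum n F : A :=
  if n is m.+1 then F 0 + (1 - p ^+ n) * bounded_sum m (fun k => F k.+1) else F 0.

Lemma bounded_sumS n F : bounded_sum n.+1 F = F 0 + (1 - p ^+ n.+1) * bounded_sum n (F \o succn).
Proof. by []. Qed.

(** As operators on [F(x) = sum_k F k x^k], [eta] replaces [x] by [x p],
    [eta_iter j] replaces it by [x p^j], and [shift] is the product by [x]. *)
Definition eta F : nat -> A := fun k => p ^+ k * F k.
Definition eta_iter j F : nat -> A := fun k => p ^+ (j * k) * F k.
Definition shift F : nat -> A := fun k => if k is k'.+1 then F k' else 0.

Lemma eq_bounded_sum n F G : F =1 G -> bounded_sum n F = bounded_sum n G.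
Proof. by elim: n F G => [|n IH] F G FG /=; rewrite FG // (IH _ (G \o succn)). Qed.

Lemma bounded_sum_lin n u v F G :
  bounded_sum n (fun k => u * F k + v * G k) = u * bounded_sum n F + v * bounded_sum n G.
Proof.
elim: n F G => [//|n IH] F G /=.
rewrite (IH (F \o succn) (G \o succn)) /=; set s := bounded_sum n _; set t := bounded_sum n _.
by rewrite /=; ring.
Qed.

Lemma bounded_sumZ n u F : bounded_sum n (fun k => u * F k) = u * bounded_sum n F.
Proof.
rewrite -[RHS]addr0 -(mul0r (bounded_sum n F)) -bounded_sum_lin; apply: eq_bounded_sum => k.
by rewrite mul0r addr0.
Qed.

Lemma bounded_sum_shift n F : bounded_sum n (shift F) = (1 - p ^+ n) * bounded_sum n.-1 F.
Proof. by case: n => [|n] /=; rewrite ?expr0 ?subrr ?mul0r ?add0r. Qed.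

(** The identity [(1 - x) / (x; p)_oo = 1 / (x p; p)_oo] in terms of
    coefficients. *)
Lemma bounded_sum_eta n F :
  bounded_sum n (eta F) = (1 - p ^+ n) * bounded_sum n.-1 (eta F) + p ^+ n * bounded_sum n F.
Proof.
have tailE m G : bounded_sum m (fun k => eta G k.+1) = p * bounded_sum m (eta (G \o succn)).
  by rewrite -bounded_sumZ; apply: eq_bounded_sum => k; rewrite /eta /= exprS mulrA.
elim: n F => [|n IH] F; first by rewrite /= /eta expr0; ring.
rewrite ![bounded_sum n.+1 _]bounded_sumS tailE IH.
case: n {IH} => [|n] /=; first by rewrite /eta !expr0; ring.
by rewrite tailE /eta !exprS expr0; ring.
Qed.

(** The value at [x = 1]: all the factors [1 - p ^+ i] in front of a nonzero
    [F k] are equal to 1. *)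
Lemma bounded_sum_sum n K F : (forall i, (n <= i)%N -> p ^+ i = 0) ->
  (forall k, (K <= k)%N -> F k = 0) -> bounded_sum (n + K) F = \sum_(k < K) F k.
Proof.
move=> pn; elim: K F => [|K IH] F FK.
  rewrite big_ord0 addn0; elim: n {pn} F FK => [|n IHn] F FK /=; rewrite FK //.
  by rewrite (IHn (F \o succn)) ?mulr0 ?addr0 // => k _; exact: FK.
rewrite addnS /= pn ?subr0 ?mul1r; last by rewrite -addnS leq_addr.
by rewrite big_ord_recl /= IH // => k Kk; exact: FK.
Qed.

#[global] Arguments bounded_sum n F : simpl never.

Variable r : A.

(** For [e = 1], [r = abc] and [F] the series of all Rogers-Ramanujan partitions,
    this is the sum that turns out to be a product.  The other values of [e]
    occur because each of the rules below changes the power of [p ^+ j] under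
    the sum. *)
Definition key_sum e F n : A :=
  \sum_(j < n.+1) r ^+ j * p ^+ (j * n + 'C(j, 2) + e * j) * qbinom n j
                 * bounded_sum (n - j) (eta_iter j F).

Lemma eq_key_sum e n F G : F =1 G -> key_sum e F n = key_sum e G n.
Proof.
move=> FG; apply: eq_bigr => j _; congr (_ * _); apply: eq_bounded_sum => k.
by rewrite /eta_iter FG.
Qed.

Lemma key_sum_lin e n u v F G :
  key_sum e (fun k => u * F k + v * G k) n = u * key_sum e F n + v * key_sum e G n.
Proof.
rewrite /key_sum !mulr_sumr -big_split /=; apply: eq_bigr => j _.
rewrite (_ : bounded_sum _ _ = u * bounded_sum (n - j) (eta_iter j F)
                      + v * bounded_sum (n - j) (eta_iter j G)); first by ring.
by rewrite -bounded_sum_lin; apply: eq_bounded_sum => k; rewrite /eta_iter; ring.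
Qed.

Lemma key_sum0 e F : key_sum e F 0 = F 0.
Proof.
by rewrite /key_sum big_ord1 /bounded_sum /= /eta_iter mul0n muln0 !expr0 qbinom0 !mul1r.
Qed.

Lemma key_sum_shift e F n :
  key_sum e (shift F) n = (1 - p ^+ n) * key_sum e.+2 F n.-1.
Proof.
have shE j : bounded_sum (n - j) (eta_iter j (shift F)) =
             p ^+ j * ((1 - p ^+ (n - j)) * bounded_sum (n - j).-1 (eta_iter j F)).
  rewrite -bounded_sum_shift -bounded_sumZ; apply: eq_bounded_sum => -[|k] /=.
    by rewrite /eta_iter /= !mulr0.
  by rewrite /eta_iter /= mulnS exprD mulrA.
case: n shE => [|n] shE; first by rewrite key_sum0 expr0 subrr mul0r.
rewrite /key_sum big_ord_recr /= shE subnn expr0 subrr mul0r !mulr0 addr0.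
rewrite mulr_sumr; apply: eq_bigr => j _; rewrite shE.
have le_jn : (j <= n.+1)%N by rewrite ltnW.
rewrite subSn -1?ltnS //= -subSn -1?ltnS //.
rewrite (_ : (j * n.+1 + _ + _ = (j * n + 'C(j, 2) + e * j) + j)%N); last first.
  by rewrite mulnS; ring.
rewrite (_ : (j * n + _ + e.+2 * j = (j * n + 'C(j, 2) + e * j) + j + j)%N);
  last by rewrite !mulSn; ring.
rewrite !exprD.
transitivity (((1 - p ^+ (n.+1 - j)) * qbinom n.+1 j) * (r ^+ j *
  (p ^+ (j * n) * p ^+ 'C(j, 2) * p ^+ (e * j) * p ^+ j * p ^+ j)
  * bounded_sum (n - j) (eta_iter j F))); first by ring.
by rewrite qbinom_absorbC //; ring.
Qed.

Lemma key_sum_eta e F n :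
  key_sum e.+1 (eta F) n =
  (1 - p ^+ n) * key_sum e.+2 (eta F) n.-1 + p ^+ n * key_sum e F n.
Proof.
have etE m j : bounded_sum m (eta_iter j (eta F)) = bounded_sum m (eta (eta_iter j F)).
  by apply: eq_bounded_sum => k; rewrite /eta_iter /eta; ring.
case: n => [|n]; first by rewrite !key_sum0 /eta expr0 /=; ring.
rewrite /key_sum [in LHS]big_ord_recr [in X in _ + X]big_ord_recr /=.
rewrite [X in _ = _ + X]mulrDr [RHS]addrA !mulr_sumr -big_split /= subnn; congr (_ + _).
  apply: eq_bigr => j _; rewrite !etE bounded_sum_eta.
  have le_jn : (j <= n.+1)%N by rewrite ltnW.
  rewrite subSn -1?ltnS //= -subSn -1?ltnS //.
  have -> : p ^+ n.+1 = p ^+ (n.+1 - j) * p ^+ j by rewrite -exprD subnK.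
  rewrite (_ : (j * n.+1 + _ + e.+1 * j = (j * n + 'C(j, 2) + e * j) + j + j)%N);
    last by rewrite mulnS mulSn; ring.
  rewrite (_ : (j * n + _ + e.+2 * j = (j * n + 'C(j, 2) + e * j) + j + j)%N);
    last by rewrite !mulSn; ring.
  rewrite (_ : (j * n.+1 + _ + e * j = (j * n + 'C(j, 2) + e * j) + j)%N);
    last by rewrite mulnS; ring.
  set N := (j * n + 'C(j, 2) + e * j)%N.
  rewrite (exprD p (N + j)) (exprD p N); set u := p ^+ N.
  transitivity (((1 - p ^+ (n.+1 - j)) * qbinom n.+1 j) * (r ^+ j *
    (u * p ^+ j * p ^+ j) * bounded_sum (n - j) (eta (eta_iter j F)))
    + p ^+ (n.+1 - j) * p ^+ j * (r ^+ j * (u * p ^+ j) * qbinom n.+1 j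
       * bounded_sum (n.+1 - j) (eta_iter j F))); first by ring.
  rewrite qbinom_absorbC //.
  have -> : p ^+ n.+1 = p ^+ (n.+1 - j) * p ^+ j by rewrite -exprD subnK.
  by ring.
rewrite /bounded_sum /eta_iter /eta !muln0 !expr0.
by rewrite [(e.+1 * _)%N]mulSn [(n.+1 + e * _)%N]addnC addnA [p ^+ (_ + n.+1)]exprD; ring.
Qed.

(** The factor [1 - p ^+ j] of the difference is absorbed by the binomial, which
    lowers [n] and [j] by one and so creates a factor [r]. *)
Lemma key_sum_step e F n :
  key_sum e F n = key_sum e.+1 F n
             + r * p ^+ (n + e) * (1 - p ^+ n) * key_sum e.+2 (eta F) n.-1.
Proof.
case: n => [|n]; first by rewrite !key_sum0 expr0 subrr mulr0 mul0r addr0.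
rewrite /key_sum [in LHS]big_ord_recl [in X in _ = X + _]big_ord_recl /=.
rewrite !muln0 -addrA; congr (_ + _).
rewrite mulr_sumr -big_split /=; apply: eq_bigr => j _.
rewrite /bump /= !add1n subSS.
rewrite (@eq_bounded_sum _ (eta_iter j (eta F)) (eta_iter j.+1 F)); last first.
  by move=> k; rewrite /eta_iter /eta mulSn exprD; ring.
rewrite (_ : (j.+1 * n.+1 + _ + e * j.+1 =
    (n.+1 + e) + (j * n + 'C(j, 2) + e.+2 * j))%N); last first.
  by rewrite binS bin1 !mulSn !mulnS; ring.
rewrite (_ : (j.+1 * n.+1 + _ + e.+1 * j.+1 =
    (n.+1 + e) + (j * n + 'C(j, 2) + e.+2 * j) + j.+1)%N); last first.
  by rewrite binS bin1 !mulSn !mulnS; ring.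
rewrite exprD (exprD _ _ j.+1) (exprD _ (n.+1 + e)).
set u := p ^+ (n.+1 + e); set v := p ^+ (_ + _).
transitivity (r ^+ j.+1 * u * v * p ^+ j.+1 * qbinom n.+1 j.+1
    * bounded_sum (n - j) (eta_iter j.+1 F)
  + ((1 - p ^+ j.+1) * qbinom n.+1 j.+1) * (r ^+ j.+1 * u * v
    * bounded_sum (n - j) (eta_iter j.+1 F))); first by ring.
by rewrite qbinom_absorb exprS; ring.
Qed.

End Bounded.

(** * The key identity *)

Section KeyIdentity.
Variables (A : comNzRingType) (a b c q : A) (M : nat).
Hypothesis qM : q ^+ M = 0.
Local Notation p := (q ^+ 2).
Local Notation eta := (eta p).
Local Notation key_sum := (key_sum p (a * b * c)).

Variables V U Y : nat -> A.
Let T k := V k + U k + Y k.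
Let W k := T k + c * U k.
Let X k := (1 + c) * T k - c * Y k.
Hypothesis V_eq : V =1 shift (fun k => q * a * eta W k).
Hypothesis U_eq : U =1 shift (fun k => q * b * eta (fun i => U i + Y i) k).
Hypothesis Y_eq : Y =1 (fun k => eta X k
  + shift (fun i => p * (a * b * eta (eta X) i + c * eta Y i)) k).

(** [1 - q ^+ m] is invertible; iterating [z = q ^+ m * z] avoids its inverse. *)
Lemma nilp_cancel m (x y : A) :
  (0 < m)%N -> (1 - q ^+ m) * x = (1 - q ^+ m) * y -> x = y.
Proof.
move=> m_gt0 /eqP; rewrite -subr_eq0 -mulrBr => /eqP E.
have {}E : x - y = q ^+ m * (x - y).
  by apply/eqP; rewrite -subr_eq0 -[X in X - _]mul1r -mulrBl E.
suff: x - y = 0 by move/eqP; rewrite subr_eq0 => /eqP.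
have {}E i : x - y = q ^+ (m * i) * (x - y).
  elim: i => [|i IH]; first by rewrite muln0 mul1r.
  by rewrite mulnS exprD -mulrA -IH.
rewrite (E M) (_ : (m * M = M + (m * M - M))%N) ?exprD ?qM ?mul0r //.
by rewrite subnKC // leq_pmull.
Qed.

Let key_sum3 e u v w F G H n :
  key_sum e (fun k => u * F k + v * G k + w * H k) n =
  u * key_sum e F n + v * key_sum e G n + w * key_sum e H n.
Proof.
rewrite (@eq_key_sum _ _ _ _ _ _ (fun k => 1 * (u * F k + v * G k) + w * H k)).
  by rewrite key_sum_lin key_sum_lin mul1r.
by move=> k; rewrite mul1r.
Qed.

Let V_key_sum e n : key_sum e V n = q * a * (1 - p ^+ n) *
  (key_sum e.+2 (eta V) n.-1 + (1 + c) * key_sum e.+2 (eta U) n.-1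
   + key_sum e.+2 (eta Y) n.-1).
Proof.
rewrite (eq_key_sum _ _ _ _ V_eq) key_sum_shift.
rewrite (@eq_key_sum _ _ _ _ _ _ (fun k => q * a * eta V k
   + q * a * (1 + c) * eta U k + q * a * eta Y k)); first by rewrite key_sum3; ring.
by move=> k; rewrite /eta /W /T; ring.
Qed.

Let U_key_sum e n : key_sum e U n = q * b * (1 - p ^+ n) *
  (key_sum e.+2 (eta U) n.-1 + key_sum e.+2 (eta Y) n.-1).
Proof.
rewrite (eq_key_sum _ _ _ _ U_eq) key_sum_shift.
rewrite (@eq_key_sum _ _ _ _ _ _ (fun k => q * b * eta U k + q * b * eta Y k)).
  by rewrite key_sum_lin; ring.
by move=> k; rewrite /eta; ring.
Qed.

Let Y_key_sum e n : key_sum e Y n = key_sum e (eta X) n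
  + p * (1 - p ^+ n) *
    (a * b * key_sum e.+2 (eta (eta X)) n.-1 + c * key_sum e.+2 (eta Y) n.-1).
Proof.
rewrite (eq_key_sum _ _ _ _ Y_eq).
rewrite (@eq_key_sum _ _ _ _ _ _ (fun k => 1 * eta X k
  + 1 * shift (fun i => p * (a * b * eta (eta X) i + c * eta Y i)) k)).
  rewrite key_sum_lin key_sum_shift (@eq_key_sum _ _ _ e.+2 _ _ (fun i =>
     p * a * b * eta (eta X) i + p * c * eta Y i)); first by rewrite key_sum_lin; ring.
  by move=> k; ring.
by move=> k; rewrite !mul1r.
Qed.

Let T_key_sum e n : key_sum e T n = key_sum e V n + key_sum e U n + key_sum e Y n.
Proof.
rewrite (@eq_key_sum _ _ _ _ _ _ (fun k => 1 * V k + 1 * U k + 1 * Y k)).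
  by rewrite key_sum3 !mul1r.
by move=> k; rewrite !mul1r.
Qed.

Let etaT_key_sum e n :
  key_sum e (eta T) n = key_sum e (eta V) n + key_sum e (eta U) n + key_sum e (eta Y) n.
Proof.
rewrite (@eq_key_sum _ _ _ _ _ _ (fun k => 1 * eta V k + 1 * eta U k + 1 * eta Y k)).
  by rewrite key_sum3 !mul1r.
by move=> k; rewrite /eta /T; ring.
Qed.

Let X_key_sum e n :
  key_sum e X n = (1 + c) * (key_sum e V n + key_sum e U n) + key_sum e Y n.
Proof.
rewrite (@eq_key_sum _ _ _ _ _ _ (fun k => (1 + c) * V k + (1 + c) * U k + 1 * Y k)).
  by rewrite key_sum3; ring.
by move=> k; rewrite /X /T; ring.
Qed.

Let etaX_key_sum e n : key_sum e (eta X) n =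
  (1 + c) * (key_sum e (eta V) n + key_sum e (eta U) n) + key_sum e (eta Y) n.
Proof.
rewrite (@eq_key_sum _ _ _ _ _ _
  (fun k => (1 + c) * eta V k + (1 + c) * eta U k + 1 * eta Y k)).
  by rewrite key_sum3; ring.
by move=> k; rewrite /eta /X /T; ring.
Qed.

(** The functional equations at level [n.+1], rewritten by the three rules,
    express everything through level [n], up to one factor [1 - p ^+ n.+1] that
    is common to both sides and can be cancelled. *)
Lemma key_sum_top n :
  key_sum 0 T n.+1 =
  let w F := key_sum 2 (eta F) n in
  (1 + c * p ^+ n.+1) * (q * a * (w V + (1 + c) * w U + w Y) + q * b * (w U + w Y))
  + w X + a * b * (p + c * p ^+ n.+1) * w (eta X) + p * c * w Y.
Proof.
apply: (@nilp_cancel (2 * n.+1)) => //; rewrite exprM /=.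
have HV := V_key_sum 0 n.+1; have HU := U_key_sum 0 n.+1.
have HY := Y_key_sum 0 n.+1; have HX := key_sum_step p (a * b * c) 0 (eta X) n.+1.
have HX' := key_sum_eta p (a * b * c) 0 X n.+1.
rewrite addn0 /= in HX; rewrite /= in HV HU HY HX'.
rewrite X_key_sum in HX'; rewrite HX' in HX; rewrite HX in HY.
rewrite T_key_sum.
set z := p ^+ n.+1 in HV HU HY *.
move: HV HU HY; set v := key_sum 0 V _; set u := key_sum 0 U _; set y := key_sum 0 Y _.
set w := key_sum 2 _ n; set w1 := key_sum 2 _ n; set w2 := key_sum 2 _ n.
set w3 := key_sum 2 _ n; set w4 := key_sum 2 _ n.
move=> HV HU HY.
(* The second summand isolates [y] minus [z] times the sum for [X], so that
   every term left has the factor [1 - z]. *)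
transitivity ((1 + c * z) * (v + u) + (y - z * ((1 + c) * (v + u) + y))).
  by ring.
by rewrite {1}HY HV HU; ring.
Qed.

(** After [key_sum_top] both sides live at level [n].  There the functional
    equations, taken at [e = 1], are three linear relations between the sums
    for [eta V], [eta U], [eta Y] at [e = 2], those for [V], [U], [Y] at
    [e = 1], and one sum for [eta (eta X)]; the claim is a linear combination
    of these relations. *)
Lemma key_sum_product n : key_sum 1 T n.+1 =
  (1 + a * q * p ^+ n) * (1 + b * q * p ^+ n) * (1 + c * p ^+ n.+1) * key_sum 1 T n.
Proof.
have HT := key_sum_step p (a * b * c) 0 T n.+1.
rewrite key_sum_top addn0 /= in HT.
have HV := V_key_sum 1 n; have HU := U_key_sum 1 n.
have HY := Y_key_sum 1 n; have HX := key_sum_step p (a * b * c) 1 (eta X) n.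
have eV := key_sum_eta p (a * b * c) 1 V n; have eU := key_sum_eta p (a * b * c) 1 U n.
have eY := key_sum_eta p (a * b * c) 1 Y n.
have eX := key_sum_eta p (a * b * c) 1 (eta X) n.
set z := p ^+ n in HV HU HY HX eV eU eY eX *.
have zE : p ^+ n.+1 = p * z by rewrite exprS.
have z1E : p ^+ (n + 1) = p * z by rewrite addn1.
rewrite zE in HT *; rewrite z1E in HX.
rewrite (etaX_key_sum 2) etaT_key_sum eX in HT; rewrite (etaX_key_sum 2) in HX.
rewrite HX in HT HY.
move/(canLR (addrK _)): eV => eV; move/(canLR (addrK _)): eU => eU.
move/(canLR (addrK _)): eY => eY; rewrite (T_key_sum 1 n).
move: HT HV HU HY; set v2 := key_sum 2 (eta V) n in eV *.
set u2 := key_sum 2 (eta U) n in eU *; set y2 := key_sum 2 (eta Y) n in eY *.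
move: eV eU eY; set v := key_sum 1 V n; set u := key_sum 1 U n; set y := key_sum 1 Y n.
set v3 := key_sum 3 (eta V) _; set u3 := key_sum 3 (eta U) _.
set y3 := key_sum 3 (eta Y) _; set k3 := key_sum 3 _ _.
move=> eV eU eY /(canLR (addrK _)) <- HV HU HY.
have {}HV : v - q * a * (v2 - z * v + (1 + c) * (u2 - z * u) + (y2 - z * y)) = 0.
  by rewrite eV eU eY {1}HV; ring.
have {}HU : u - q * b * (u2 - z * u + (y2 - z * y)) = 0.
  by rewrite eU eY {1}HU; ring.
have {}HY : y - ((1 + c) * (v2 + u2) + y2 + a * b * p * (1 + c * z) * ((1 - z) * k3)
                 + p * c * (y2 - z * y)) = 0.
  by rewrite eY {1}HY; ring.
apply/eqP; rewrite -subr_eq0; apply/eqP.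
(* [(1 + c p z)] times the relations for [V] and [U] replaces the linear terms
   in [q a] and [q b].  Of the products by [q b z] and [- q a c z], the first
   comes from [V = T - (U + Y)] and the second from [W = T + c U].  The relation
   for [Y] is used once as it stands and once for the term in [z ^+ 2]. *)
set hv := v - _ in HV; set hu := u - _ in HU; set hy := y - _ in HY.
transitivity (- (1 + c * (p * z)) * hv * (1 + q * b * z)
  - (1 + c * (p * z)) * hu * (1 - q * a * c * z)
  - (1 + a * b * c * p * z ^+ 2) * hy); last by rewrite HV HU HY; ring.
by rewrite /hv /hu /hy; ring.
Qed.

End KeyIdentity.

(** For large [n] the factor [p ^+ (j * n)] kills all terms but [j = 0]. *)
Section Limit.
Variables (A : comNzRingType) (p r : A) (N K : nat) (F : nat -> A).
Hypothesis pN : forall i, (N <= i)%N -> p ^+ i = 0.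
Hypothesis FK : forall k, (K <= k)%N -> F k = 0.

Lemma key_sum_limit e : key_sum p r e F (N + K) = \sum_(k < K) F k.
Proof.
rewrite /key_sum big_ord_recl big1 => [|j _]; last first.
  by rewrite pN ?mulr0 ?mul0r // lift0 mulSn -!addnA leq_addr.
rewrite /= !muln0 mul0n qbinom0 subn0 !expr0 !mul1r addr0 -(bounded_sum_sum pN FK).
by apply: eq_bounded_sum => k; rewrite /eta_iter mul0n expr0 mul1r.
Qed.
End Limit.

(** * Chains and weights read from the least part *)

Section BottomUp.

Definition bcons x (cs : seq (seq nat)) : seq (seq nat) :=
  if cs is chi :: cs' then
    if last 0%N chi == (x + 2)%N then rcons chi x :: cs' else [:: x] :: cs
  else [:: [:: x]].

(** The argument lists the parts in increasing order, so that a new least part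
    is added by [cons].  The chains come from the bottom up, but each chain is
    still decreasing, as in [chains]. *)
Definition bchains (s : seq nat) := rev (chains (rev s)).

Lemma chains_neq0 p : all (fun chi => chi != [::]) (chains p).
Proof.
have [_ /allP bl _] := chainsP p.
by apply/allP => chi /bl /andP[].
Qed.

Lemma chains_rcons p x : rev (chains (rcons p x)) = bcons x (rev (chains p)).
Proof.
elim: p => [//|y p IH] /=.
move: IH (chains_neq0 p) => /(canRL revK) ->; case: (chains p) => [|d cs].
  by rewrite /= addn2; case: ifP.
case/lastP: cs => [|cs chi] /=.
  rewrite andbT; case: d => [//|d0 d] _; rewrite [rev [:: d0 :: d]]/rev /=.
  by case: ifP => l; rewrite /rev /=; case: ifP; rewrite /= ?l.
move=> /andP[d0 _]; rewrite -rcons_cons rev_rcons rev_cons /=.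
case: ifP => l; rewrite -?rcons_cons rev_cons ?rev_cons rev_rcons revK /=;
  by case: ifP => _; rewrite !(rev_cons, rev_rcons) /= l.
Qed.

Lemma bchains_cons x s : bchains (x :: s) = bcons x (bchains s).
Proof. by rewrite /bchains rev_cons chains_rcons. Qed.
End BottomUp.

Section ChainWeights.
Variables (R : comNzRingType) (a b c : R).

(** The part of the weight of an odd chain given by the words whose lowest
    letter is [a]; the only other word is [b ^+ l]. *)
Definition a_word l : R :=
  a ^+ l + (1 + c) * (\sum_(1 <= k < l) a ^+ k * b ^+ (l - k)).

(** The lowest chain is the only one that a new least part can extend, so its
    weight [f] is left open.  The value at the empty list never occurs in the
    sums over lists with a given least part; 0 makes the definition linear. *)
Definition bottom_weight (f : nat -> R) (s : seq nat) : R :=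
  if bchains s is chi :: cs
  then f (size chi) * \prod_(d <- cs) chain_weight a b c d else 0.

Definition weight_a := bottom_weight a_word.
Definition weight_b := bottom_weight (GRing.exp b).
Definition weight_up s : R := \prod_(chi <- bchains s) chain_weight a b c chi.

Lemma weight_up_rev s : weight_up s = weight a b c (rev s).
Proof. by apply: perm_big; rewrite perm_rev. Qed.

Lemma a_wordS l : (0 < l)%N -> a_word l.+1 = a * (a_word l + (1 + c) * b ^+ l).
Proof.
case: l => // l _; rewrite /a_word big_nat_recl // subSS subn0 expr1 mulrDr.
have -> : \sum_(1 <= k < l.+1) a ^+ k.+1 * b ^+ (l.+2 - k.+1) =
          a * \sum_(1 <= k < l.+1) a ^+ k * b ^+ (l.+1 - k).
  by rewrite mulr_sumr; apply: eq_bigr => k _; rewrite exprS subSS mulrA.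
by rewrite exprS; ring.
Qed.

Lemma last_bchains s : last 0%N (head [::] (bchains s)) = head 0%N s.
Proof.
case: s => [//|x s]; rewrite bchains_cons; case: (bchains s) => [//|chi cs] /=.
by case: ifP; rewrite ?last_rcons.
Qed.

(** A part [m + 2] continues the chain of [m]; any larger next part starts a new
    chain, and then all the chains of [s] have their usual weight. *)
Lemma bottom_weight_cons f g m s :
  (forall l, (0 < l)%N -> f l.+1 = g l) ->
  bottom_weight f (m :: s) =
  if head 0%N s == (m + 2)%N then bottom_weight g s else f 1%N * weight_up s.
Proof.
move=> fg; rewrite -last_bchains /bottom_weight /weight_up bchains_cons.
case: (bchains s) => [|chi cs] /=; first by rewrite addn2 !big_nil.
case: ifP => // /eqP l; rewrite size_rcons fg //.
by case: chi l => //=; rewrite addn2.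
Qed.

Lemma bottom_weightZ u f s :
  bottom_weight (fun l => u * f l) s = u * bottom_weight f s.
Proof. by rewrite /bottom_weight; case: bchains => [|*]; rewrite ?mulr0 ?mulrA. Qed.

Lemma bottom_weightD f g s :
  bottom_weight (fun l => f l + g l) s = bottom_weight f s + bottom_weight g s.
Proof. by rewrite /bottom_weight; case: bchains => [|*]; rewrite ?addr0 ?mulrDl. Qed.

Lemma chain_weight_odd chi : odd (last 0%N chi) ->
  chain_weight a b c chi = (if last 0%N chi == 1%N then 1 else 1 + c)
                           * (a_word (size chi) + b ^+ size chi).
Proof.
by move=> o; rewrite /chain_weight o /=; case: ifP => _; rewrite ?mul1r.
Qed.

Lemma weight_up_odd m s : odd m ->
  weight_up (m :: s) = (if m == 1%N then 1 else 1 + c) * (weight_a (m :: s) + weight_b (m :: s)).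
Proof.
have := last_bchains (m :: s); rewrite /weight_up /weight_a /weight_b /bottom_weight bchains_cons.
case E : (bcons m (bchains s)) => [|chi cs] /=.
  by case: (bchains s) E => [|d ds] //=; case: ifP.
by move=> <- o; rewrite big_cons chain_weight_odd // -mulrDl mulrA.
Qed.

Lemma weight_up_even m s : ~~ odd m ->
  weight_up (m :: s) = (if head 0%N s == (m + 2)%N then c else c + a * b) * weight_up s.
Proof.
move=> ev; rewrite -last_bchains /weight_up bchains_cons.
case: (bchains s) => [|chi cs] /=.
  by rewrite big_seq1 big_nil addn2 /chain_weight /= ev expr0 mul1r mulr1.
case: ifP => [/eqP l|_]; rewrite !big_cons; last first.
  by rewrite {1}/chain_weight /= ev expr0 mul1r.
rewrite mulrA; congr (_ * _).
rewrite /chain_weight last_rcons l oddD addbF ev size_rcons mulrA -exprS.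
by case: chi l => [|x chi] //=; rewrite ?addn2 // !subn1.
Qed.

End ChainWeights.

(** * Enumeration of Rogers-Ramanujan partitions with parts in an interval *)

Section Enumeration.

(** The parts range over the [d] integers from [m] on.  After a part [m] they
    start again at [m.+2]; if [d' = 0], the truncated [d'.-1] leaves just the
    empty tail, as it should. *)
Fixpoint rr_seqs d m : seq (seq nat) :=
  if d is d'.+1 then rr_seqs d' m.+1 ++ map (cons m) (rr_seqs d'.-1 m.+2)
  else [:: [::]].

Lemma rr_seqsS d m :
  rr_seqs d.+1 m = rr_seqs d m.+1 ++ map (cons m) (rr_seqs d.-1 m.+2).
Proof. by []. Qed.

Definition gap2 x y := (x + 2 <= y)%N.

Lemma gap2_trans : transitive gap2.
Proof.
by move=> y x z xy yz; apply: leq_trans xy (leq_trans (leq_addr 2 y) yz).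
Qed.

Lemma mem_rr_seqs d m s : (s \in rr_seqs d m) =
  [&& sorted gap2 s, all (leq m) s & all (gtn (m + d)%N) s].
Proof.
have [n le_dn] := ubnP d; elim: n => // n IH in d m s le_dn *.
case: d le_dn => [_|d]; last (rewrite ltnS => le_dn; rewrite rr_seqsS mem_cat).
  rewrite inE addn0; case: s => [|x s] //=.
  by case: leqP; rewrite /= ?andbF // => _; rewrite !andbF.
have -> : (m + d.+1 = m.+1 + d)%N by rewrite addnS.
rewrite {1}IH //; case: s => [|x s]; first by [].
have [->|ne_xm] := eqVneq x m; last first.
  rewrite (_ : (x :: s \in map _ _) = false) ?orbF; last first.
    by apply/mapP => -[t _ [E _]]; rewrite E eqxx in ne_xm.
  rewrite [all (leq m.+1) _]/= [all (leq m) _]/= [(m < x)%N]ltn_neqAle.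
  rewrite eq_sym ne_xm /=; case xs : (path gap2 x s) => //=.
  case mx : (m <= x)%N => //=.
  have ge_s : all (leq m.+1) s.
    move: xs; rewrite path_sortedE => [/andP[h _]|]; last exact: gap2_trans.
    apply: sub_all h => y; rewrite /gap2 addn2; apply: leq_trans.
    by rewrite ltnW // ltnS ltnW // ltnS.
  have ge_s' : all (leq m) s by apply: sub_all ge_s => y; exact: ltnW.
  by rewrite ge_s ge_s'.
rewrite /= ltnn andbF /= (mem_map (fun _ _ => _)); last by move=> ? ? [].
rewrite leqnn [(m < m.+1 + d)%N]leq_addr /=.
rewrite path_sortedE; last exact: gap2_trans.
have allE : all (gap2 m) s = all (leq m.+2) s.
  by apply: eq_all => y; rewrite /gap2 addn2.
rewrite allE.
have ge_m : all (leq m.+2) s -> all (leq m) s.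
  by apply: sub_all => y h; rewrite ltnW // ltnW.
case: d le_dn => [|d] le_dn.
  rewrite inE; case: s {allE} ge_m => [|y s] //= _.
  rewrite addn0 ltnS; case: (leqP y m) => [le_ym|_]; last by rewrite !andbF.
  by rewrite [(m.+1 < y)%N]ltnNge (leq_trans le_ym).
rewrite IH; last exact: ltnW.
rewrite (_ : (m.+2 + d.+1.-1 = m.+1 + d.+1)%N); last by rewrite addnS.
case hs : (all (leq m.+2) s); rewrite ?andbF //= ge_m //.
Qed.

Lemma rr_seqs_uniq d m : uniq (rr_seqs d m).
Proof.
have [n le_dn] := ubnP d; elim: n => // n IH in d m le_dn *.
case: d le_dn => [//|d]; rewrite ltnS => le_dn.
rewrite rr_seqsS cat_uniq IH // map_inj_uniq ?IH; last by move=> ? ? [].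
  rewrite andbT /=; apply/hasPn => _ /mapP[s _ ->].
  by rewrite mem_rr_seqs /= ltnn andbF.
exact: leq_ltn_trans (leq_pred d) le_dn.
Qed.

Lemma rr_seqs_size d m s : s \in rr_seqs d m -> (size s <= d)%N.
Proof.
have [n le_dn] := ubnP d; elim: n => // n IH in d m s le_dn *.
case: d le_dn => [_|d]; first by rewrite inE => /eqP ->.
rewrite ltnS => le_dn; rewrite rr_seqsS mem_cat => /orP[/IH h|].
  by rewrite ltnW // ltnS h.
move=> /mapP[t /IH h ->] /=; rewrite ltnS (leq_trans (h _)) ?leq_pred //.
exact: leq_ltn_trans (leq_pred d) le_dn.
Qed.

Lemma rr_seqs_head d m n s :
  s \in rr_seqs d n -> (0 < m < n)%N -> (head 0%N s == m) = false.
Proof.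
rewrite mem_rr_seqs => /and3P[_ ge_n _] /andP[m0 mn].
case: s ge_n => [|x s] /=; first by case: m m0 mn.
by case/andP=> nx _; rewrite eq_sym ltn_eqF // (leq_trans mn).
Qed.

End Enumeration.

(** * Weighted sums over these partitions and their recurrences *)

Section Sums.
Variables (A : comNzRingType) (a b c q : A) (M : nat).
Hypothesis qM : q ^+ M = 0.
Implicit Types (g : seq nat -> A) (m k : nat).

(** As [q ^+ M = 0], parts up to [M - 1] are enough. *)
Let E m := rr_seqs (M - m) m.

Definition rr_sum g m k : A :=
  \sum_(s <- E m | size s == k) g s * q ^+ sumn s.
Definition rr_sum_from g m k : A :=
  \sum_(s <- E m | (size s == k) && (head 0%N s == m)) g s * q ^+ sumn s.

Let q_large m : (M <= m)%N -> q ^+ m = 0.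
Proof. by move=> Mm; rewrite -(subnKC Mm) exprD qM mul0r. Qed.

Let E_large m : (M <= m)%N -> E m = [:: [::]].
Proof. by rewrite /E -subn_eq0 => /eqP ->. Qed.

Let E_cons m : (m < M)%N -> E m = E m.+1 ++ map (cons m) (E m.+2).
Proof. by move=> mM; rewrite /E -(subnSK mM) rr_seqsS -subnS. Qed.

Lemma rr_sum_not_from g m k : (0 < m)%N ->
  \sum_(s <- E m | (size s == k) && (head 0%N s != m)) g s * q ^+ sumn s =
  rr_sum g m.+1 k.
Proof.
move=> m0; rewrite /rr_sum; have [mM|Mm] := ltnP m M; last first.
  rewrite !E_large ?(leq_trans Mm) // !big_cons !big_nil /=.
  by rewrite [0%N == m]eq_sym -lt0n m0 andbT.
rewrite (E_cons mM) big_cat /= [X in _ + X]big1_seq ?addr0; last first.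
  by move=> s /andP[/andP[_ hs] /mapP[t _ sE]]; rewrite sE /= eqxx in hs.
rewrite [LHS]big_seq_cond [RHS]big_seq_cond; apply: eq_bigl => s.
case sE : (s \in _) => //=; rewrite (rr_seqs_head sE) ?andbT //.
by rewrite m0 ltnSn.
Qed.

Lemma rr_sum_split g m k : (0 < m)%N ->
  rr_sum g m k = rr_sum g m.+1 k + rr_sum_from g m k.
Proof.
move=> m0; rewrite -rr_sum_not_from // addrC /rr_sum.
exact: (bigID (fun s => head 0%N s == m)).
Qed.

Lemma rr_sum_from0 g m : (0 < m)%N -> rr_sum_from g m 0 = 0.
Proof.
move=> m0; apply: big1 => -[|//] /=.
by rewrite eq_sym eqn0Ngt m0.
Qed.

(** Removing the least part [m]: the remaining list either starts with [m + 2],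
    in which case the chain of [m] goes on, or has all its parts above it. *)
Lemma rr_sum_from_cons g g1 g2 m k : (0 < m)%N ->
  (forall s, g (m :: s) = if head 0%N s == (m + 2)%N then g1 s else g2 s) ->
  rr_sum_from g m k.+1 = q ^+ m * (rr_sum_from g1 m.+2 k + rr_sum g2 m.+3 k).
Proof.
move=> m0 gE; rewrite /rr_sum_from; have [mM|Mm] := ltnP m M; last first.
  rewrite q_large // mul0r E_large // big_cons big_nil /=; by [].
rewrite (E_cons mM) big_cat /= big1_seq ?add0r; last first.
  by move=> s /andP[/andP[_ +] sE]; rewrite (rr_seqs_head sE) ?m0 ?ltnSn.
rewrite big_map /= (bigID (fun s => head 0%N s == m.+2)) /= mulrDr.
rewrite -rr_sum_not_from // !mulr_sumr; congr (_ + _).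
  apply: eq_big => [s|s /andP[_ hs]]; first by rewrite eqSS eqxx andbT.
  by rewrite gE addn2 hs exprD; ring.
apply: eq_big => [s|s /andP[_ /negPf hs]]; first by rewrite eqSS eqxx andbT.
by rewrite gE addn2 hs exprD; ring.
Qed.

Lemma rr_sum_fromZ u g m k :
  rr_sum_from (fun s => u * g s) m k = u * rr_sum_from g m k.
Proof. by rewrite /rr_sum_from mulr_sumr; apply: eq_bigr => s _; rewrite mulrA. Qed.

Lemma rr_sumZ u g m k : rr_sum (fun s => u * g s) m k = u * rr_sum g m k.
Proof. by rewrite /rr_sum mulr_sumr; apply: eq_bigr => s _; rewrite mulrA. Qed.

Lemma rr_sum_fromD g h m k :
  rr_sum_from (fun s => g s + h s) m k = rr_sum_from g m k + rr_sum_from h m k.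
Proof.
by rewrite /rr_sum_from -big_split; apply: eq_bigr => s _; rewrite mulrDl.
Qed.

Lemma rr_sum_large g m k : (M <= m)%N -> rr_sum g m k = if k is 0 then g [::] else 0.
Proof.
move=> Mm; rewrite /rr_sum E_large // big_cons big_nil /= eq_sym.
by case: k => //=; rewrite mulr1 addr0.
Qed.

Lemma rr_sum_from_large g m k : (0 < m)%N -> (M <= m)%N -> rr_sum_from g m k = 0.
Proof.
move=> m0 Mm; rewrite /rr_sum_from E_large // big_cons big_nil /=.
by rewrite [0%N == m]eq_sym eqn0Ngt m0 andbF.
Qed.

Lemma rr_sum_eq0 g m k : (M < k)%N -> rr_sum g m k = 0.
Proof.
move=> Mk; rewrite /rr_sum big1_seq // => s /andP[/eqP sk /rr_seqs_size].
by rewrite sk => /(leq_trans Mk); rewrite ltnNge leq_subr.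
Qed.

Lemma rr_sum_from_eq0 g m k : (M < k)%N -> rr_sum_from g m k = 0.
Proof.
move=> Mk; rewrite /rr_sum_from big1_seq // => s /andP[/andP[/eqP sk _] /rr_seqs_size].
by rewrite sk => /(leq_trans Mk); rewrite ltnNge leq_subr.
Qed.

Local Notation p := (q ^+ 2).
Local Notation al := (rr_sum_from (weight_a a b c)).
Local Notation be := (rr_sum_from (weight_b a b c)).
Local Notation ev := (rr_sum (weight_up a b c)).

Lemma sum_from_b_rec m k : (0 < m)%N ->
  be m k.+1 = q ^+ m * b * (be m.+2 k + ev m.+3 k).
Proof.
move=> m0; rewrite (@rr_sum_from_cons _ (fun s => b * weight_b a b c s)
   (fun s => b * weight_up a b c s)) // ?rr_sum_fromZ ?rr_sumZ; first by ring.
move=> s; rewrite /weight_b (@bottom_weight_cons _ _ _ _ _ (fun l => b * b ^+ l)).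
  by rewrite bottom_weightZ expr1.
by move=> l _; rewrite exprS.
Qed.

Lemma sum_from_a_rec m k : (0 < m)%N ->
  al m k.+1 = q ^+ m * a * (al m.+2 k + (1 + c) * be m.+2 k + ev m.+3 k).
Proof.
move=> m0; rewrite (@rr_sum_from_cons _
   (fun s => a * (weight_a a b c s + (1 + c) * weight_b a b c s))
   (fun s => a * weight_up a b c s)) //.
  by rewrite rr_sum_fromZ rr_sumZ rr_sum_fromD rr_sum_fromZ; ring.
move=> s; rewrite /weight_a (@bottom_weight_cons _ _ _ _ _
    (fun l => a * (a_word a b c l + (1 + c) * b ^+ l))); last exact: a_wordS.
rewrite bottom_weightZ bottom_weightD bottom_weightZ.
by rewrite {2}/a_word big_geq // mulr0 addr0 expr1.
Qed.

(** Part 1 is excluded because its chain lacks the factor [1 + c]. *)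
Lemma sum_rec_odd m k : odd m -> (1 < m)%N ->
  ev m k = ev m.+1 k + (1 + c) * (al m k + be m k).
Proof.
move=> om m1; rewrite rr_sum_split ?(ltnW m1) //; congr (_ + _).
rewrite -rr_sum_fromD -rr_sum_fromZ /rr_sum_from; apply: eq_bigr => s.
case/andP=> _; case: s => [|x s] /=; first by rewrite eq_sym -leqn0 leqNgt ltnW.
by move/eqP->; rewrite weight_up_odd // gtn_eqF.
Qed.

Lemma sum_rec_even m k : ~~ odd m -> (0 < m)%N ->
  ev m k.+1 = ev m.+1 k.+1 + q ^+ m * (c * ev m.+2 k + a * b * ev m.+3 k).
Proof.
move=> em m0; rewrite rr_sum_split //; congr (_ + _).
rewrite (@rr_sum_from_cons _ (fun s => c * weight_up a b c s)
  (fun s => (c + a * b) * weight_up a b c s)) //; last first.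
  by move=> s; rewrite weight_up_even //; case: ifP.
rewrite rr_sum_fromZ rr_sumZ (rr_sum_split _ (m := m.+2)) //; ring.
Qed.

(** Adding 2 to every part keeps gaps and parities, hence weights.  The proof
    does not go through a bijection of lists: the recurrences at [m] and at
    [m.+2] differ by powers of [p] only, and they determine the sums downwards
    from [M].  The sums [ev] start at [m.+1] because the partitions with a
    part 1 do not have the same weight after a translation. *)
Lemma sums_shift m k : (0 < m)%N ->
  [/\ al m.+2 k = p ^+ k * al m k, be m.+2 k = p ^+ k * be m k &
      ev m.+3 k = p ^+ k * ev m.+1 k].
Proof.
have [n] := ubnP (M - m); elim: n => // n IH in m k *; rewrite ltnS => le_n m0.
have [Mm|mM] := leqP M m.
  rewrite !rr_sum_from_large ?mulr0 ?(leq_trans Mm) ?leqW //.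
  rewrite !rr_sum_large ?(leq_trans Mm) ?leqW //; split=> //.
  by case: k => [|k] /=; rewrite ?mulr0 ?expr0 ?mul1r.
have IHi i k' : [/\ al (m + i).+3 k' = p ^+ k' * al (m + i).+1 k',
    be (m + i).+3 k' = p ^+ k' * be (m + i).+1 k' &
    ev (m + i).+4 k' = p ^+ k' * ev (m + i).+2 k'].
  apply: IH => //; rewrite -(subnSK mM) in le_n.
  by apply: leq_ltn_trans le_n; rewrite leq_sub2l // ltnS leq_addr.
have [al3 be3 ev4] := IHi 0 k; rewrite addn0 in al3 be3 ev4.
have sh4 k' : [/\ al m.+4 k' = p ^+ k' * al m.+2 k',
    be m.+4 k' = p ^+ k' * be m.+2 k' & ev m.+4.+1 k' = p ^+ k' * ev m.+3 k'].
  by have := IHi 1 k'; rewrite addn1.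
have ev6 k' : ev m.+2.+4 k' = p ^+ k' * ev m.+4 k'.
  by have [_ _] := IHi 2 k'; rewrite addn2.
have qS : q ^+ m.+2 = p * q ^+ m by rewrite -exprD.
have qS1 : q ^+ m.+3 = p * q ^+ m.+1 by rewrite -exprD.
have pS k' : p ^+ k'.+1 = p * p ^+ k' by rewrite exprS.
split.
- case: k {al3 be3 ev4} => [|k]; first by rewrite !rr_sum_from0 ?mulr0.
  rewrite !sum_from_a_rec // qS pS; have [-> -> ->] := sh4 k.
  by move: (p ^+ k) p (q ^+ m) => P Q u; ring.
- case: k {al3 be3 ev4} => [|k]; first by rewrite !rr_sum_from0 ?mulr0.
  rewrite !sum_from_b_rec // qS pS; have [_ -> ->] := sh4 k.
  by move: (p ^+ k) p (q ^+ m) => P Q u; ring.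
have om3 : odd m.+3 = odd m.+1 by rewrite /= negbK.
case: (boolP (odd m.+1)) => om.
  rewrite (sum_rec_odd _ (m := m.+3)) ?om3 // ev4 al3 be3.
  rewrite (sum_rec_odd _ (m := m.+1)) //.
  by move: (p ^+ k) => P; ring.
case: k {al3 be3} ev4 => [|k] ev4.
  rewrite (rr_sum_split _ _ (m := m.+3)) // ev4 (rr_sum_split _ _ (m := m.+1)) //.
  by rewrite !rr_sum_from0 // !addr0.
rewrite (sum_rec_even _ (m := m.+3)) ?om3 // ev4.
rewrite (sum_rec_even _ (m := m.+1)) // qS1 pS.
have [_ _ ->] := sh4 k; rewrite ev6.
by move: (p ^+ k) p (q ^+ m.+1) => P Q u; ring.
Qed.

End Sums.

(** * The generating function of Rogers-Ramanujan partitions *)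

Section Nilpotent.
Variables (A : comNzRingType) (a b c q : A) (M : nat).
Hypothesis qM : q ^+ M = 0.
Local Notation p := (q ^+ 2).
Local Notation al := (rr_sum_from q M (weight_a a b c) 1).
Local Notation be := (rr_sum_from q M (weight_b a b c) 1).
Local Notation ev := (rr_sum q M (weight_up a b c)).

(** The series [eta X]: raised by 2, the partitions with a part 1 gain the factor
    [1 + c], which is why [X] is [(1 + c) * (V + U) + Y] and not [T]. *)
Lemma sum_min3E k :
  ev 3 k = p ^+ k * ((1 + c) * (al k + be k + ev 2 k) - c * ev 2 k).
Proof.
have [a3 b3 e4] := sums_shift a b c qM k (isT : (0 < 1)%N).
rewrite (sum_rec_odd _ _ _ _ _ _ (m := 3)) // a3 b3 e4.
by move: (p ^+ k) => P; ring.
Qed.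

Lemma rr_sum_size0 g m : (0 < m)%N -> rr_sum q M g m 0 = g [::].
Proof.
have [n] := ubnP (M - m); elim: n m => // n IH m; rewrite ltnS => le_n m0.
have [Mm|mM] := leqP M m; first by rewrite rr_sum_large.
rewrite rr_sum_split // rr_sum_from0 // addr0 IH //.
by rewrite -(subnSK mM) in le_n.
Qed.

Lemma rr_sum1E k : rr_sum q M (weight_up a b c) 1 k = al k + be k + ev 2 k.
Proof.
rewrite rr_sum_split // addrC; congr (_ + _).
rewrite -rr_sum_fromD /rr_sum_from; apply: eq_bigr => s /andP[_].
by case: s => [|x s] //= /eqP ->; rewrite weight_up_odd // eqxx mul1r.
Qed.

Lemma sum_rr_sum g m :
  \sum_(k < M.+1) rr_sum q M g m k = \sum_(s <- rr_seqs (M - m) m) g s * q ^+ sumn s.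
Proof.
rewrite /rr_sum; under eq_bigr => k _ do rewrite big_mkcond.
rewrite exchange_big /= big_seq [RHS]big_seq; apply: eq_bigr => s /rr_seqs_size le_s.
have lt_s : (size s < M.+1)%N by rewrite ltnS (leq_trans le_s) ?leq_subr.
by rewrite -big_mkcond (big_pred1 (Ordinal lt_s)) // => k; rewrite eq_sym.
Qed.

(** The number of factors is chosen to reach the range of [key_sum_limit]: the
    powers [p ^+ i] vanish from [M] on, the sums over [k] parts from [M.+1]. *)
Lemma rr_generating_function :
  \sum_(s <- rr_seqs (M - 1) 1) weight_up a b c s * q ^+ sumn s =
  \prod_(i < M + M.+1) ((1 + a * q * p ^+ i) * (1 + b * q * p ^+ i)
                        * (1 + c * p ^+ i.+1)).
Proof.
pose T k := al k + be k + ev 2 k.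
have TM k : (M.+1 <= k)%N -> T k = 0.
  by move=> Mk; rewrite /T !rr_sum_from_eq0 ?rr_sum_eq0 ?addr0.
have pM i : (M <= i)%N -> p ^+ i = 0.
  by move=> Mi; rewrite exprAC -(subnKC Mi) exprD qM mul0r expr0n.
rewrite -sum_rr_sum (eq_bigr (fun k : 'I_M.+1 => T k)) => [|k _]; last exact: rr_sum1E.
rewrite -(key_sum_limit (a * b * c) pM TM 1).
elim: (M + M.+1)%N => [|n IH].
  by rewrite key_sum0 big_ord0 /T !rr_sum_from0 // rr_sum_size0 // !add0r /weight_up big_nil.
rewrite big_ord_recr -IH [RHS]mulrC; apply: (@key_sum_product _ a b c q M qM al be (ev 2)) => k.
- case: k => [|k] /=; first by rewrite rr_sum_from0.
  rewrite sum_from_a_rec // /eta expr1; have [-> -> ->] := sums_shift a b c qM k (isT : (0 < 1)%N).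
  by move: (p ^+ k) => P; ring.
- case: k => [|k] /=; first by rewrite rr_sum_from0.
  rewrite sum_from_b_rec // /eta expr1; have [_ -> ->] := sums_shift a b c qM k (isT : (0 < 1)%N).
  by move: (p ^+ k) => P; ring.
rewrite /eta -sum_min3E; case: k => [|k] /=.
  by rewrite rr_sum_split // rr_sum_from0 // addr0 addr0.
rewrite sum_rec_even //; congr (_ + _ * _); rewrite -sum_min3E.
have [_ _ ->] := sums_shift a b c qM k (isT : (0 < 1)%N).
have [_ _ ->] := sums_shift a b c qM k (isT : (0 < 2)%N).
by rewrite addrC.
Qed.
End Nilpotent.

(** * The generating function of vector partitions *)

Section Distinct.

Fixpoint distinct_seqs (f : nat -> nat) N : seq (seq nat) :=
  if N is N'.+1
  then distinct_seqs f N' ++ map (cons (f N')) (distinct_seqs f N')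
  else [:: [::]].

Lemma distinct_seqs_sum (A : comNzRingType) (u q : A) f N :
  \sum_(s <- distinct_seqs f N) u ^+ size s * q ^+ sumn s =
  \prod_(i < N) (1 + u * q ^+ f i).
Proof.
elim: N => [|N IH]; first by rewrite big_ord0 big_seq1 !expr0 mulr1.
rewrite big_ord_recr /= -IH big_cat big_map /= mulrDr mulr1; congr (_ + _).
by rewrite mulr_suml; apply: eq_bigr => s _; rewrite exprS exprD; ring.
Qed.

Variable f : nat -> nat.
Hypothesis f_mono : {mono f : i j / (i < j)%N}.

Lemma mem_distinct_seqs N s :
  (s \in distinct_seqs f N) = sorted gtn s && all (mem (map f (iota 0 N))) s.
Proof.
elim: N s => [|N IH] s; first by case: s => [|x s] //=; rewrite andbF.
rewrite [distinct_seqs _ _]/= mem_cat IH -addn1 iotaD map_cat /= add0n.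
have fN x : x \in map f (iota 0 N) -> (x < f N)%N.
  by case/mapP=> i; rewrite mem_iota => /andP[_ iN] ->; rewrite f_mono.
have gtn_tr : transitive gtn by move=> y x z xy yz; exact: ltn_trans yz xy.
have ltE x (s' : seq nat) : (x <= f N)%N -> path gtn x s' ->
    all (mem (map f (iota 0 N) ++ [:: f N])) s' = all (mem (map f (iota 0 N))) s'.
  move=> xN; rewrite path_sortedE // => /andP[/allP lt_x _].
  apply: eq_in_all => y /lt_x lt_yx.
  by rewrite /= mem_cat inE [y == _]ltn_eqF ?orbF // (leq_trans lt_yx).
case: s => [|x s] //; have [->|ne] := eqVneq x (f N).
  rewrite (mem_map (fun _ _ => _)) ?IH; last by move=> ? ? [].
  rewrite /= mem_cat mem_seq1 eqxx orbT.
  have /negPf -> : f N \notin map f (iota 0 N) by apply/negP => /fN; rewrite ltnn.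
  rewrite andbF /=; apply/andP/andP => -[ss Is]; last first.
    by rewrite -(ltE (f N)) ?(path_sorted ss).
  have ps : path gtn (f N) s.
    by rewrite path_sortedE // ss andbT; apply: sub_all Is => y; exact: fN.
  by rewrite (ltE (f N)).
rewrite (_ : (x :: s \in map _ _) = false) ?orbF; last first.
  by apply/mapP => -[t _ [E _]]; rewrite E eqxx in ne.
rewrite /= mem_cat mem_seq1 (negPf ne) orbF.
case ps : (path gtn x s) => //=; case xI : (x \in _) => //=.
by rewrite (ltE x) // ltnW // fN.
Qed.

Lemma distinct_seqs_uniq N : uniq (distinct_seqs f N).
Proof.
elim: N => [//|N IH]; rewrite [distinct_seqs _ _]/= cat_uniq IH.
rewrite map_inj_uniq ?IH ?andbT; last by move=> ? ? [].
apply/hasPn => _ /mapP[s _ ->]; rewrite mem_distinct_seqs /=.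
apply/negP => /and3P[_ /mapP[i]]; rewrite mem_iota add0n => /andP[_ iN] /eqP.
by rewrite gtn_eqF // f_mono.
Qed.

End Distinct.

Definition vector_seqs N : seq (seq nat * seq nat * seq nat) :=
  let O := distinct_seqs (fun i => i.*2.+1) N in
  [seq (uv, w) | uv <- [seq (u, v) | u <- O, v <- O],
                 w <- distinct_seqs (fun i => i.*2.+2) N].

Lemma vector_seqs_sum (A : comNzRingType) (a b c q : A) N :
  \sum_(v <- vector_seqs N) a ^+ size v.1.1 * b ^+ size v.1.2 * c ^+ size v.2
    * q ^+ (sumn v.1.1 + sumn v.1.2 + sumn v.2) =
  \prod_(i < N) ((1 + a * q * (q ^+ 2) ^+ i) * (1 + b * q * (q ^+ 2) ^+ i)
                 * (1 + c * (q ^+ 2) ^+ i.+1)).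
Proof.
rewrite !big_split /=.
have oddE u : \prod_(i < N) (1 + u * q * (q ^+ 2) ^+ i) =
    \sum_(s <- distinct_seqs (fun i => i.*2.+1) N) u ^+ size s * q ^+ sumn s.
  rewrite distinct_seqs_sum; apply: eq_bigr => i _.
  by rewrite -mulrA -exprM -exprS mul2n.
have evenE u : \prod_(i < N) (1 + u * (q ^+ 2) ^+ i.+1) =
    \sum_(s <- distinct_seqs (fun i => i.*2.+2) N) u ^+ size s * q ^+ sumn s.
  by rewrite distinct_seqs_sum; apply: eq_bigr => i _; rewrite -exprM mul2n doubleS.
rewrite !oddE evenE /vector_seqs big_allpairs_dep big_allpairs_dep /=.
rewrite [in RHS]big_distrlr /= !mulr_suml; apply: eq_bigr => u _.
rewrite mulr_suml; apply: eq_bigr => v _.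
by rewrite mulr_sumr; apply: eq_bigr => w _; rewrite !exprD; ring.
Qed.

Lemma all_gtn_sumn B s : (sumn s < B)%N -> all (gtn B) s.
Proof.
elim: s => [//|x s IH] /= lt_B.
by rewrite (leq_ltn_trans (leq_addr _ _) lt_B) IH // (leq_ltn_trans _ lt_B) ?leq_addl.
Qed.

Lemma sorted_gtnE s : sorted gtn s = sorted geq s && uniq s.
Proof. by rewrite andbC; exact: gtn_sorted_uniq_geq. Qed.

Lemma mem_odd_seqs N s : (s \in distinct_seqs (fun i => i.*2.+1) N) =
  distinct_odd s && all (gtn N.*2) s.
Proof.
rewrite mem_distinct_seqs; last by move=> i j /=; rewrite ltnS ltn_double.
have memE x : (x \in [seq i.*2.+1 | i <- iota 0 N]) = odd x && (x < N.*2)%N.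
  apply/mapP/andP => [[i]|[ox xN]].
    rewrite mem_iota => /andP[_ iN] ->; split; first by rewrite /= odd_double.
    by rewrite -doubleS in iN *; rewrite -ltn_double in iN; lia.
  exists x./2; last by rewrite -add1n -[1%N]/(nat_of_bool true) -ox odd_double_half.
  by rewrite mem_iota add0n; lia.
rewrite (eq_all memE) (all_predI odd (gtn N.*2)) sorted_gtnE.
rewrite /distinct_odd /is_partition.
case: (sorted geq s) => //=; case: (uniq s); rewrite ?andbF //=.
case os : (all odd s); rewrite ?andbF //= andbT.
by have -> : all (leq 1) s by apply: sub_all os => -[].
Qed.

Lemma mem_even_seqs N s : (s \in distinct_seqs (fun i => i.*2.+2) N) =
  distinct_even s && all (gtn N.*2.+1) s.
Proof.
rewrite mem_distinct_seqs; last by move=> i j /=; rewrite !ltnS ltn_double.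
have memE x : (x \in [seq i.*2.+2 | i <- iota 0 N]) =
    [&& 0 < x, ~~ odd x & x < N.*2.+1]%N.
  apply/mapP/and3P => [[i]|[x0 ox xN]].
    by rewrite mem_iota => /andP[_ iN] ->; split; rewrite //= ?odd_double //; lia.
  by exists x./2.-1; [rewrite mem_iota add0n|]; lia.
rewrite (eq_all memE) (all_predI (leq 1) (fun x => ~~ odd x && (x < N.*2.+1)%N)).
rewrite (all_predI (fun x => ~~ odd x) (gtn N.*2.+1)) sorted_gtnE.
rewrite /distinct_even /is_partition.
by case: (sorted geq s) => //=; case: (uniq s); case: (all (leq 1) s).
Qed.

Lemma vector_seqs_uniq N : uniq (vector_seqs N).
Proof.
have uO : uniq (distinct_seqs (fun i => i.*2.+1) N).
  by apply: distinct_seqs_uniq => i j /=; rewrite ltnS ltn_double.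
have uE : uniq (distinct_seqs (fun i => i.*2.+2) N).
  by apply: distinct_seqs_uniq => i j /=; rewrite !ltnS ltn_double.
apply: allpairs_uniq => //; last by move=> [? ?] [? ?].
by apply: allpairs_uniq => //; move=> [? ?] [? ?].
Qed.

(** * From the generating functions to the theorem *)

Lemma truncation_ring (R : comNzRingType) n :
  exists (A : comNzRingType) (f : {rmorphism {poly R} -> A}),
    f 'X ^+ n.+1 = 0 /\ forall P Q, f P = f Q -> P`_n = Q`_n.
Proof.
have mk_monicXn : mk_monic ('X^(n.+1) : {poly R}) = 'X^(n.+1).
  by rewrite /mk_monic size_polyXn monicXn.
exists {poly %/ ('X^(n.+1) : {poly R})}, (in_qpoly 'X^(n.+1)); split.
  rewrite -rmorphXn; apply: val_inj; rewrite /= mk_monicXn.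
  exact/Pdiv.RingMonic.rmodpp/monicXn.
have coef_in_qpoly (P : {poly R}) :
    (in_qpoly ('X^(n.+1) : {poly R}) P : {poly R})`_n = P`_n.
  rewrite /in_qpoly /= mk_monicXn -Pdiv.RingMonic.take_poly_rmodp.
  by rewrite coef_take_poly ltnSn.
by move=> P Q PQ; rewrite -coef_in_qpoly PQ coef_in_qpoly.
Qed.

Lemma coef_sum_monomials (R : comNzRingType) (I : Type) (r : seq I)
    (F : I -> R) (d : I -> nat) n :
  (\sum_(i <- r) (F i)%:P * 'X^(d i))`_n = \sum_(i <- r | d i == n) F i.
Proof.
rewrite coef_sum [RHS]big_mkcond; apply: eq_bigr => i _.
by rewrite coefCM coefXn eq_sym; case: eqP; rewrite ?mulr1 ?mulr0.
Qed.

Lemma rmorph_sum_monomials (R A : comNzRingType) (f : {rmorphism {poly R} -> A})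
    (I : Type) (r : seq I) (F : I -> R) (d : I -> nat) :
  f (\sum_(i <- r) (F i)%:P * 'X^(d i)) = \sum_(i <- r) f (F i)%:P * f 'X ^+ d i.
Proof. by rewrite rmorph_sum; apply: eq_bigr => i _; rewrite rmorphM rmorphXn. Qed.

Lemma rmorph_weight (R S : comNzRingType) (f : {rmorphism R -> S}) (a b c : R) p :
  f (weight a b c p) = weight (f a) (f b) (f c) p.
Proof.
rewrite rmorph_prod; apply: eq_bigr => chi _; rewrite /chain_weight.
have sE l : f (a ^+ l + (1 + c) * (\sum_(1 <= k < l) a ^+ k * b ^+ (l - k)) + b ^+ l)
  = f a ^+ l + (1 + f c) * (\sum_(1 <= k < l) f a ^+ k * f b ^+ (l - k)) + f b ^+ l.
  rewrite !rmorphD rmorphM rmorphD rmorph1 !rmorphXn rmorph_sum; congr (_ + _ * _ + _).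
  by apply: eq_bigr => k _; rewrite rmorphM !rmorphXn.
case: ifP => _; first by rewrite rmorphM rmorphD rmorphM rmorphXn.
case: ifP => _; first exact: sE.
by rewrite rmorphM rmorphD rmorph1 sE.
Qed.

Lemma VP_of_seqs n N : (n < N)%N ->
  VP_of n = [set` [seq v <- vector_seqs N
                  | (sumn v.1.1 + sumn v.1.2 + sumn v.2)%N == n]]%classic.
Proof.
move=> nN; apply/seteqP; split=> -[[u v] w] /=; rewrite mem_filter /=.
  move=> [/and3P[/= hu hv hw] sE]; rewrite sE eqxx /=.
  apply/allpairsP; exists ((u, v), w); split=> //=.
    by apply/allpairsP; exists (u, v); rewrite /= !mem_odd_seqs hu hv !all_gtn_sumn //; lia.
  by rewrite mem_even_seqs hw all_gtn_sumn //; lia.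
move=> /andP[/eqP sE /allpairsP[[uv w'] /= [/allpairsP[[u' v'] /= [hu hv ->]] hw]]].
move=> [eu ev ew]; move: hu hv hw; rewrite -eu -ev -ew !mem_odd_seqs mem_even_seqs.
move=> /andP[hu _] /andP[hv _] /andP[hw _]; split=> //.
by apply/and3P; split.
Qed.

Lemma RR_of_seqs n :
  RR_of n = [set` [seq rev s | s <- rr_seqs n 1 & sumn s == n]]%classic.
Proof.
have gap2_rev p : sorted gap2 (rev p) = pairwise (fun x y => y + 2 <= x)%N p.
  by rewrite rev_sorted sorted_pairwise // => y x z h1 h2; exact: gap2_trans h2 h1.
apply/seteqP; split=> p /=.
  move=> [/andP[/andP[_ p1] pp] sE]; apply/mapP; exists (rev p); last by rewrite revK.
  rewrite mem_filter sumn_rev sE eqxx /= mem_rr_seqs gap2_rev pp !all_rev p1.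
  by rewrite all_gtn_sumn // sE add1n.
move=> /mapP[s]; rewrite mem_filter mem_rr_seqs => /andP[/eqP sE /and3P[ss s1 _]] ->.
rewrite /RR_of /= sumn_rev; split=> //.
rewrite /rogers_ramanujan -gap2_rev revK ss andbT /is_partition all_rev s1 andbT.
rewrite rev_sorted; apply: sub_sorted ss => x y.
exact: leq_trans (leq_addr 2 x).
Qed.

Theorem theorem1 (R : comNzRingType) (a b c : R) (n : nat) :
  \sum_(p \in RR_of n) weight a b c p =
  \sum_(v \in VP_of n) a ^+ size v.1.1 * b ^+ size v.1.2 * c ^+ size v.2.
Proof.
have [A [f [fX f_coef]]] := truncation_ring R n.
pose N := (n.+1 + n.+2)%N; have nN : (n < N)%N by rewrite /N; lia.
rewrite RR_of_seqs (VP_of_seqs nN) -!fsbig_seq; last 2 first.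
- by rewrite filter_uniq // vector_seqs_uniq.
- by rewrite map_inj_uniq ?filter_uniq ?rr_seqs_uniq //; exact: (can_inj revK).
rewrite big_map !big_filter -!coef_sum_monomials; apply: f_coef.
have GF := rr_generating_function (f a%:P) (f b%:P) (f c%:P) fX.
rewrite subSS subn0 -vector_seqs_sum in GF.
rewrite !rmorph_sum_monomials.
have fw p : f (weight a b c p)%:P = weight (f a%:P) (f b%:P) (f c%:P) p.
  exact: (rmorph_weight (f \o polyC)).
under eq_bigr => s _ do rewrite fw -weight_up_rev.
rewrite [LHS]GF; apply: eq_bigr => v _.
by rewrite !rmorphM !rmorphXn.
Qed.
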